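(* Let $\mathbb{L}$ be a linearly ordered set. Then the free Banach lattice $FBL\langle\mathbb{L}\rangle$ generated by $\mathbb{L}$ has the countable chain condition if and only if $\mathbb{L}$ is order-isomorphic to a subset of the real line.
   Context: A linearly ordered set $\mathbb{L}$ is regarded as a lattice with $\wedge=\min$ and $\vee=\max$. The free Banach lattice $FBL\langle\mathbb{L}\rangle$ is taken in the following concrete form. Let $\mathbb{L}^\ast$ be the set of all lattice homomorphisms $x^\ast:\mathbb{L}\to[-1,1]$ (for linearly ordered $\mathbb{L}$, these are exactly the nondecreasing functions). For $x\in\mathbb{L}$ let $\delta_x:\mathbb{L}^\ast\to\mathbb{R}$, $\delta_x(x^\ast)=x^\ast(x)$. For $f:\mathbb{L}^\ast\to\mathbb{R}$ let $$\|f\|_\ast=\sup\Big\{\sum_{i=1}^n|f(x_i^\ast)| : n\in\mathbb{N},\ x_1^\ast,\ldots,x_n^\ast\in\mathbb{L}^\ast,\ \sup_{x\in\mathbb{L}}\sum_{i=1}^n|x_i^\ast(x)|\le 1\Big\}.$$ Then $FBL\langle\mathbb{L}\rangle$ is the smallest norm-closed vector sublattice containing $\{\delta_x:x\in\mathbb{L}\}$ inside the Banach lattice of all $f:\mathbb{L}^\ast\to\mathbb{R}$ with $\|f\|_\ast<\infty$, with norm $\|\cdot\|_\ast$ and pointwise operations. A Banach lattice $X$ has the countable chain condition if whenever $\{f_i:i\in I\}\subset X$ is a family of positive nonzero elements ($f_i\ge 0$, $f_i\neq 0$) with $f_i\wedge f_j=0$ for all $i\ne j$, the index set $I$ is countable.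 *)

(* Defs.v *)
From HB Require Import structures.
From mathcomp Require Import all_boot all_order all_algebra.
From mathcomp Require Import all_classical all_reals all_analysis.

Set Implicit Arguments.
Unset Strict Implicit.
Unset Printing Implicit Defensive.

Import Order.TTheory GRing.Theory Num.Theory.
Local Open Scope classical_set_scope.
Local Open Scope ring_scope.

Record lattice_dual (R : realType) (d : Order.disp_t) (L : orderType d) :=
  LatticeDual {
    dual_fun :> L -> R;
    dual_min : forall x y : L,
      dual_fun (Order.min x y) = Order.min (dual_fun x) (dual_fun y);
    dual_max : forall x y : L,
      dual_fun (Order.max x y) = Order.max (dual_fun x) (dual_fun y);
    dual_itv : forall x : L, dual_fun x \in `[-1, 1]
  }.

Section FreeBanachLattice.
Variables (R : realType) (d : Order.disp_t) (L : orderType d).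

Local Notation Ls := (lattice_dual R L).

Definition delta (x : L) : Ls -> R := fun xs => xs x.

Definition admissible (n : nat) (xs : 'I_n -> Ls) : Prop :=
  (ereal_sup [set (\sum_(i < n) `|xs i x|)%:E | x in [set: L]] <= 1)%E.

Definition fbl_norm (f : Ls -> R) : \bar R :=
  ereal_sup [set s | exists (n : nat) (xs : 'I_n -> Ls),
    admissible xs /\ s = (\sum_(i < n) `|f (xs i)|)%:E].

Definition fbl_ambient : set (Ls -> R) := [set f | (fbl_norm f < +oo)%E].

(* closedness relative to [fbl_ambient], for the metric of [fbl_norm] *)
Definition norm_closed (A : set (Ls -> R)) : Prop :=
  forall f : Ls -> R, fbl_ambient f ->
    (forall e : R, 0 < e -> exists2 g, A g & (fbl_norm (f - g)%R < e%:E)%E) ->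
    A f.

End FreeBanachLattice.

(* Sets of real functions are ordered pointwise, so the lattice operations are
   [\min] and [\max]. *)
Definition vector_sublattice (R : realType) (T : Type) (A : set (T -> R)) :
    Prop :=
  [/\ A 0,
      forall f g, A f -> A g -> A (f + g),
      forall (a : R) f, A f -> A (a *: f),
      forall f g, A f -> A g -> A (f \min g)
    & forall f g, A f -> A g -> A (f \max g)].

Definition FBL (R : realType) (d : Order.disp_t) (L : orderType d) :
    set (lattice_dual R L -> R) :=
  \bigcap_(A in [set A : set (lattice_dual R L -> R) |
      [/\ A `<=` fbl_ambient (L := L), vector_sublattice A, norm_closed A
        & forall x : L, A (delta x)]]) A.
Arguments FBL R {d} L.

Definition has_ccc (R : realType) (T : Type) (X : set (T -> R)) : Prop :=
  forall (I : Type) (f : I -> T -> R),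
    (forall i, [/\ X (f i), forall t, 0 <= f i t & f i <> 0]) ->
    (forall i j, i <> j -> f i \min f j = 0) ->
    countable [set: I].

Definition order_isomorphic_to (R : realType) (d : Order.disp_t)
    (L : orderType d) (S : set R) : Prop :=
  exists2 phi : L -> R, set_bij [set: L] S phi
    & {mono phi : x y / (x <= y)%O}.
Arguments order_isomorphic_to {R d} L S.

(* Main.v *)
(* If L embeds in R, rational step functions with rational cuts form a countable
   pointwise dense subset of L^*; elements of FBL<L> are pointwise continuous, so
   members of a disjoint family are positive at distinct points of this set.

   Conversely, under the ccc the jumps x < y of L are countably many, because the
   functions min(-delta_x, delta_y)^+ are disjoint.  As in the proof that the
   square of a Suslin line is not ccc, take by Zorn a maximal family of triples
   a < b < c such that of two distinct triples at least one does not capture the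
   middle point of the other between its ends.  The functions "x^* crosses -1/2
   in (a, b] and 1/2 in (b, c]" are disjoint, so the family is countable, and by
   maximality its middle points meet every nonempty open interval of L.  Together
   with the jumps this gives a countable D that meets every (x, y] with x < y,
   and D yields an embedding into R by summing a geometric series. *)

Require Import Defs.
From mathcomp Require Import all_boot all_order all_algebra.
From mathcomp Require Import all_classical all_reals all_analysis.
From mathcomp Require Import lra.
Set Implicit Arguments.
Unset Strict Implicit.
Unset Printing Implicit Defensive.

Import Order.TTheory GRing.Theory Num.Theory.
Import numFieldNormedType.Exports.
Local Open Scope classical_set_scope.

Lemma countable_setU (T : Type) (A B : set T) :
  countable A -> countable B -> countable (A `|` B).
Proof.
move=> cA cB; rewrite -bigcup2E; apply: bigcup_countable => // -[|[|n]] _ //=.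
Qed.

(** * Pointwise continuity of the elements of the free Banach lattice *)

Section LatticeDual.
Local Open Scope ring_scope.
Context {R : realType} {d : Order.disp_t} {L : orderType d}.
Local Notation Ls := (lattice_dual R L).

Lemma dual_nondecreasing (z : Ls) (x y : L) : (x <= y)%O -> z x <= z y.
Proof. by move=> /min_idPl xy; apply/min_idPl; rewrite -dual_min xy. Qed.

Lemma dual_bound (z : Ls) (x : L) : -1 <= z x <= 1.
Proof. by have := dual_itv z x; rewrite in_itv. Qed.

Lemma nondecreasing_dual (h : L -> R) :
  (forall x y : L, (x <= y)%O -> h x <= h y) -> (forall x, -1 <= h x <= 1) ->
  exists z : Ls, forall x, z x = h x.
Proof.
move=> hnd hb.
have hmin (x y : L) : h (Order.min x y) = Order.min (h x) (h y).
  by case: (leP x y) => [/hnd/min_l|/ltW/hnd/min_r] ->.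
have hmax (x y : L) : h (Order.max x y) = Order.max (h x) (h y).
  by case: (leP x y) => [/hnd/max_r|/ltW/hnd/max_l] ->.
have hitv x : h x \in `[-1, 1] by rewrite in_itv /= hb.
by exists (LatticeDual hmin hmax hitv).
Qed.

Lemma admissible1 (z : Ls) : admissible (fun _ : 'I_1 => z).
Proof.
apply/ereal_supP => _ [x _ <-]; rewrite big_ord1 lee_fin ler_norml.
exact: dual_bound.
Qed.

Lemma admissible_sum_le1 (n : nat) (xs : 'I_n -> Ls) (x : L) :
  admissible xs -> \sum_(i < n) `|xs i x| <= 1.
Proof. by move=> /ereal_supP h; rewrite -lee_fin; apply: h; exists x. Qed.

Lemma fbl_norm_ge (f : Ls -> R) (z : Ls) : (`|f z|%:E <= fbl_norm f)%E.
Proof.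
apply: ereal_sup_ubound; exists 1%N, (fun=> z); split; first exact: admissible1.
by rewrite big_ord1.
Qed.

Lemma fbl_ambientP (f : Ls -> R) : fbl_ambient f <-> exists M : R,
  forall (n : nat) (xs : 'I_n -> Ls), admissible xs ->
    \sum_(i < n) `|f (xs i)| <= M.
Proof.
split=> [|[M hM]]; last first.
  apply: (@le_lt_trans _ _ M%:E); last exact: ltry.
  by apply/ereal_supP => _ [n [xs [/hM h ->]]].
rewrite /fbl_ambient /=.
case E : (fbl_norm f) => [M| |] // _; [exists M|exists 0] => n xs adm.
- by rewrite -lee_fin -E; apply: ereal_sup_ubound; exists n, xs.
- have : ((\sum_(i < n) `|f (xs i)|)%:E <= fbl_norm f)%E.
    by apply: ereal_sup_ubound; exists n, xs.
  by rewrite E.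
Qed.

(** Continuity for the topology that L^* inherits from the product R^L; [s] and [r] give a basic
    neighbourhood of [z]. *)
Definition pointwise_continuous (f : Ls -> R) : Prop :=
  forall (z : Ls) (e : R), 0 < e -> exists (s : seq L) (r : R), 0 < r /\
    forall y : Ls, (forall x, x \in s -> `|z x - y x| < r) -> `|f z - f y| < e.

(** Serves addition, min and max at once: each is 1-Lipschitz for the l^1 norm of the plane and
    vanishes at the origin. *)
Lemma lipschitz_ambient (op : R -> R -> R) (f g : Ls -> R) : op 0 0 = 0 ->
  (forall a b a' b', `|op a b - op a' b'| <= `|a - a'| + `|b - b'|) ->
  fbl_ambient f -> fbl_ambient g -> fbl_ambient (fun z => op (f z) (g z)).
Proof.
move=> op0 opL /fbl_ambientP[M hM] /fbl_ambientP[N hN]; apply/fbl_ambientP.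
exists (M + N) => n xs adm; apply: le_trans (lerD (hM _ _ adm) (hN _ _ adm)).
rewrite -big_split /=; apply: ler_sum => i _.
by have := opL (f (xs i)) (g (xs i)) 0 0; rewrite op0 !subr0.
Qed.

Lemma lipschitz_continuous (op : R -> R -> R) (f g : Ls -> R) :
  (forall a b a' b', `|op a b - op a' b'| <= `|a - a'| + `|b - b'|) ->
  pointwise_continuous f -> pointwise_continuous g ->
  pointwise_continuous (fun z => op (f z) (g z)).
Proof.
move=> opL cf cg z e e0; have e20 : 0 < e / 2 by rewrite divr_gt0.
have [s [r [r0 hf]]] := cf z _ e20; have [t [q [q0 hg]]] := cg z _ e20.
exists (s ++ t), (Num.min r q); split=> [|y zy]; first by rewrite lt_min r0.
rewrite [ltRHS]splitr; apply: le_lt_trans (opL _ _ _ _) (ltrD (hf _ _) (hg _ _)).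
- by move=> x xs; have := zy x; rewrite mem_cat xs lt_min => /(_ isT)/andP[].
- by move=> x xt; have := zy x; rewrite mem_cat xt orbT lt_min => /(_ isT)/andP[].
Qed.

Lemma minr_lipschitz (a b a' b' : R) :
  `|Num.min a b - Num.min a' b'| <= `|a - a'| + `|b - b'|.
Proof.
have := normr_ge0 (a - a'); have := normr_ge0 (b - b').
have := ler_norm (a - a'); have := ler_norm (b - b').
have := lerNnormlW (lexx `|a - a'|); have := lerNnormlW (lexx `|b - b'|).
by rewrite ler_norml; case: (leP a b); case: (leP a' b') => *; lra.
Qed.

Lemma maxr_lipschitz (a b a' b' : R) :
  `|Num.max a b - Num.max a' b'| <= `|a - a'| + `|b - b'|.
Proof.
have := normr_ge0 (a - a'); have := normr_ge0 (b - b').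
have := ler_norm (a - a'); have := ler_norm (b - b').
have := lerNnormlW (lexx `|a - a'|); have := lerNnormlW (lexx `|b - b'|).
by rewrite ler_norml; case: (leP a b); case: (leP a' b') => *; lra.
Qed.

Lemma addr_lipschitz (a b a' b' : R) :
  `|(a + b) - (a' + b')| <= `|a - a'| + `|b - b'|.
Proof. by rewrite opprD addrACA ler_normD. Qed.

(** The continuous functions in [fbl_ambient] form one of the sets intersected in [FBL]. They are
    norm closed because one-element families are admissible, so the norm dominates the uniform
    norm. *)
Lemma FBL_pointwise_continuous (f : Ls -> R) :
  FBL R L f -> pointwise_continuous f.
Proof.
pose A := [set f : Ls -> R | fbl_ambient f /\ pointwise_continuous f].
suff hA : [/\ A `<=` fbl_ambient (L := L), vector_sublattice A, norm_closed A
    & forall x : L, A (delta x)] by move=> /(_ A hA)[].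
split=> [g []//|||x].
- split.
  + split; last by move=> z e e0; exists [::], 1; split=> // y _; rewrite subrr normr0.
    by apply/fbl_ambientP; exists 0 => n xs _; rewrite big1// => i _; rewrite normr0.
  + move=> g h [ag cg] [ah ch]; split.
    * by exact: (@lipschitz_ambient +%R g h (addr0 _) addr_lipschitz).
    * exact: (@lipschitz_continuous +%R g h addr_lipschitz).
  + move=> a g [/fbl_ambientP[M hM] cg]; split.
      apply/fbl_ambientP; exists (`|a| * M) => n xs adm.
      apply: le_trans (ler_wpM2l (normr_ge0 a) (hM _ _ adm)).
      by rewrite mulr_sumr; apply: ler_sum => i _; rewrite -normrM.
    move=> z e e0; have a0 : 0 < `|a| + 1 by rewrite ltr_wpDl.
    have [s [r [r0 hr]]] := cg z (e / (`|a| + 1)) (divr_gt0 e0 a0).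
    exists s, r; split=> // y /hr; rewrite ltr_pdivlMr// => h.
    have -> : (a *: g) z - (a *: g) y = a * (g z - g y) by rewrite mulrBr.
    rewrite normrM; apply: le_lt_trans h; rewrite mulrC.
    by rewrite ler_wpM2l// lerDl.
  + move=> g h [ag cg] [ah ch]; split.
    * by exact: (@lipschitz_ambient Num.min g h (minxx _) minr_lipschitz).
    * exact: (@lipschitz_continuous Num.min g h minr_lipschitz).
  + move=> g h [ag cg] [ah ch]; split.
    * by exact: (@lipschitz_ambient Num.max g h (maxxx _) maxr_lipschitz).
    * exact: (@lipschitz_continuous Num.max g h maxr_lipschitz).
- move=> g ag happrox; split=> // z e e0.
  have e30 : 0 < e / 3 by rewrite divr_gt0.
  have [h [_ ch] gh] := happrox _ e30.
  have close w : `|g w - h w| < e / 3.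
    by rewrite -lte_fin; apply: le_lt_trans gh; exact: (fbl_norm_ge (g - h)).
  have [s [r [r0 hr]]] := ch z _ e30; exists s, r; split=> // y /hr.
  have := close z; have := close y; rewrite !ltr_norml.
  by move=> /andP[? ?] /andP[? ?] /andP[? ?]; apply/andP; split; lra.
- split; last first.
    move=> z e e0; exists [:: x], e; split=> // y; apply.
    by rewrite mem_seq1.
  by apply/fbl_ambientP; exists 1 => n xs; exact: admissible_sum_le1.
Qed.

End LatticeDual.

(** * Suborders of the line satisfy the chain condition *)

Section EmbeddableCCC.
Local Open Scope ring_scope.
Context {R : realType} {d : Order.disp_t} {L : orderType d} (phi : L -> R).
Hypothesis phi_mono : {mono phi : x y / (x <= y)%O}.
Local Notation Ls := (lattice_dual R L).

(** Entries of [s] are pairs (cut, value). The default -1 and the cap 1 keep all values in [-1, 1],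
    so every member of the countable type [seq (rat * rat)] is a legal index. *)
Definition step (s : seq (rat * rat)) (x : L) : R :=
  \big[Num.max/-1]_(p <- s | ratr p.1 < phi x) Num.min 1 (ratr p.2).

Lemma step_nondecreasing s (x y : L) : (x <= y)%O -> step s x <= step s y.
Proof.
rewrite -phi_mono => xy; apply: sub_bigmax => p /lt_le_trans; exact.
Qed.

Lemma step_bound s x : -1 <= step s x <= 1.
Proof.
by rewrite bigmax_ge_id bigmax_le// => p _; rewrite ge_min lexx.
Qed.

Definition step_dual s : Ls :=
  sval (cid (nondecreasing_dual (@step_nondecreasing s) (step_bound s))).

Lemma step_dualE s x : step_dual s x = step s x.
Proof. by rewrite /step_dual; case: cid. Qed.

(* [z] is approximated from below on [s] by the step function that jumps to a
   rational value just below [z x] at a rational cut separating [phi x] from the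
   image of the smaller elements of [s]. *)
Lemma step_dual_dense (z : Ls) (s : seq L) (r : R) : 0 < r ->
  exists t, forall x, x \in s -> `|z x - step_dual t x| < r.
Proof.
move=> r0.
have cut x : exists q : rat,
    (forall y, y \in s -> (y < x)%O -> phi y <= ratr q) /\ ratr q < phi x.
  (* The default [phi x - 1] keeps [m] below [phi x] when nothing in [s] precedes [x]. *)
  pose m := \big[Num.max/phi x - 1]_(y <- s | (y < x)%O) phi y.
  have /rat_in_itvoo[q] : m < phi x.
    apply: bigmax_lt => [|y]; first by rewrite ltrBlDr ltrDl.
    by rewrite -(leW_mono phi_mono).
  rewrite in_itv /= => /andP[mq qx]; exists q; split=> // y ys yx.
  by apply: le_trans (ltW mq); apply: le_bigmax_seq.
have val x : exists v : rat, z x - r < ratr v < z x.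
  have /rat_in_itvoo[v] : z x - r < z x by rewrite ltrBlDr ltrDl.
  by rewrite in_itv; exists v.
have [q hq] := choice cut; have [v hv] := choice val.
exists [seq (q x, v x) | x <- s] => x xs.
have /andP[vx1 vx2] := hv x; have /andP[_ z1] := dual_bound z x.
rewrite step_dualE /step big_map; set b := bigop _ _ _.
(* The entry of [x] itself contributes [v x]; the cap is harmless since [v x] < [z x] <= 1. *)
have lb : ratr (v x) <= b.
  rewrite /b; apply: (@Order.TotalTheory.bigmax_sup_seq _ _ _ _ _ x) => //=.
    by case: (hq x).
  by rewrite le_min lexx andbT (le_trans (ltW vx2)).
(* By the choice of cuts, only entries of some y <= x contribute, and [v y] < [z y] <= [z x]. *)
have ub : b <= z x.
  rewrite /b big_seq_cond; apply: bigmax_le => [|y /andP[ys /= qyx]].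
    by case/andP: (dual_bound z x).
  have yx : (y <= x)%O.
    rewrite leNgt; apply/negP => xy.
    by have [/(_ x xs xy)] := hq y; rewrite leNgt qyx.
  have /andP[_ vy] := hv y.
  by rewrite ge_min (le_trans (ltW vy)) ?orbT// dual_nondecreasing.
by rewrite ltr_norml; apply/andP; split; lra.
Qed.

Lemma embeddable_ccc : has_ccc (FBL R L).
Proof.
move=> I f hf disj.
have pos i : exists t, 0 < f i (step_dual t).
  have [Fi fi0 fiN0] := hf i.
  have [z fz] : exists z, 0 < f i z.
    apply: contra_notP fiN0 => /forallNP h; apply/funext => z.
    by apply/eqP; rewrite eq_le fi0 andbT leNgt; apply/negP/h.
  have [s [r [r0 hr]]] := FBL_pointwise_continuous Fi z fz.
  have [t /hr] := step_dual_dense z s r0.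
  by move=> h; exists t; move: h; rewrite ltr_norml => /andP[_]; lra.
have [t ht] := choice pos.
apply/countable_injP; exists (choice.pickle \o t) => i j _ _ /= /(pcan_inj choice.pickleK) tij.
apply: contrapT => /disj /(congr1 (fun g => g (step_dual (t i)))) /= fij.
have := ht j; rewrite -tij => fj.
have : 0 < Num.min (f i (step_dual (t i))) (f j (step_dual (t i))).
  by rewrite lt_min ht fj.
by rewrite fij ltxx.
Qed.

End EmbeddableCCC.

(** * Countability of jumps and of separated families under the chain condition *)

Section CCCEmbeddable.
Local Open Scope ring_scope.
Context {R : realType} {d : Order.disp_t} {L : orderType d}.
Local Notation Ls := (lattice_dual R L).

Lemma FBL_vector_sublattice : vector_sublattice (FBL R L).
Proof.
split=> [A [_ []]//|f g Ff Fg A hA|a f Ff A hA|f g Ff Fg A hA|f g Ff Fg A hA];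
  case: (hA) => _ [_ AD AZ Amin Amax] _ _;
  [apply: AD|apply: AZ|apply: Amin|apply: Amax]; solve [exact: Ff|exact: Fg].
Qed.

Lemma FBL_delta (x : L) : FBL R L (delta x).
Proof. by move=> A []. Qed.

Hypothesis ccc : has_ccc (FBL R L).

(** The functions [p t] may change sign, so the chain condition is applied to their positive
    parts. *)
Lemma ccc_countable (T : Type) (A : set T) (p : T -> Ls -> R) :
  (forall t, FBL R L (p t)) -> (forall t, A t -> exists z, 0 < p t z) ->
  (forall t t' z, A t -> A t' -> 0 < p t z -> 0 < p t' z -> t = t') ->
  countable A.
Proof.
move=> Fp posp disjp; have [F0 _ _ _ Fmax] := FBL_vector_sublattice.
have : countable [set: set_type A].
  apply: (ccc (f := fun t => 0 \max p (val t))) => [t|t t' tt'].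
    split=> [|z|p0]; first exact: Fmax.
    - by rewrite /= le_max lexx.
    - have [z pz] := posp _ (set_mem (valP t)).
      have max0 : Num.max 0 (p (val t) z) = 0 := congr1 (fun g => g z) p0.
      have : p (val t) z <= Num.max 0 (p (val t) z) by rewrite le_max lexx orbT.
      by rewrite max0 leNgt pz.
  apply/funext => z /=; apply/eqP; rewrite eq_le le_min !le_max !lexx !andbT.
  rewrite leNgt lt_min !lt_max ltxx /=; apply/negP => /andP[pt pt'].
  by apply: tt'; apply: val_inj; apply: disjp pt pt'; apply: set_mem; apply: valP.
move=> cA; have -> : A = val @` [set: set_type A].
  apply/seteqP; split=> [t At|_ [t _ <-]]; last exact: set_mem (valP t).
  by exists (SigSub (mem_set At)).
exact: sub_countable (card_image_le _ _) cA.
Qed.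

Definition jump (t : L * L) : Prop :=
  (t.1 < t.2)%O /\ forall z, ~~ (t.1 < z < t.2)%O.

Lemma countable_jump : countable jump.
Proof.
have [_ _ FZ Fmin _] := FBL_vector_sublattice.
apply: (ccc_countable (p := fun t => (-1 *: delta t.1) \min delta t.2)).
- by move=> t; apply: Fmin; [apply: FZ|]; apply: FBL_delta.
- move=> [x y] [/= xy _].
  pose h w : R := if (w < y)%O then -1 else 1.
  have hnd v w : (v <= w)%O -> h v <= h w.
    move=> vw; rewrite /h; case: (ltP w y) => wy; first by rewrite (le_lt_trans vw wy).
    by case: ifP => _; lra.
  have hb w : -1 <= h w <= 1 by rewrite /h; case: ifP => _; lra.
  have [z zE] := nondecreasing_dual hnd hb; exists z.
  rewrite /= lt_min /delta; apply/andP; split.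
    by change (0 < -1 * z x); rewrite zE /h xy; lra.
  by rewrite zE /h ltxx.
move=> [x y] [x' y'] z [/= xy jxy] [/= xy' jxy'].
rewrite !lt_min => /andP[zx zy] /andP[zx' zy'].
have {}zx : z x < 0 by change (is_true (0 < -1 * z x)) in zx; lra.
have {}zx' : z x' < 0 by change (is_true (0 < -1 * z x')) in zx'; lra.
have lt_neg_pos v w : z v < 0 -> 0 < z w -> (v < w)%O.
  move=> zv zw; rewrite ltNge; apply/negP => /(dual_nondecreasing z).
  by move=> /(lt_le_trans zw); rewrite ltNge (ltW zv).
(* Each left end lies below the other right end; as both intervals are empty, the ends coincide. *)
have xy'' := lt_neg_pos _ _ zx zy'; have x'y := lt_neg_pos _ _ zx' zy.
have := jxy y'; rewrite xy'' -leNgt => yy'.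
have := jxy' y; rewrite x'y -leNgt => y'y.
have := jxy x'; rewrite x'y andbT -leNgt => x'x.
have := jxy' x; rewrite xy'' andbT -leNgt => xx'.
by congr pair; apply: le_anti; apply/andP.
Qed.

Section Triples.
Variable e : L.

(** With middle point [e] the bump below could never be positive: that would require |z e| < |z e| /
    2. *)
Definition triple (t : L * L * L) : Prop :=
  (t.1.1 < t.1.2 < t.2)%O /\ t.1.2 <> e.

Definition captures (t t' : L * L * L) : bool := (t.1.1 < t'.1.2 < t.2)%O.

Definition separated (A : set (L * L * L)) : Prop := A `<=` triple /\
  forall t t', A t -> A t' -> captures t t' -> captures t' t -> t = t'.

(** This is |delta e| / 2. All of [FBL] vanishes at the zero function of L^*, so nonzero constants
    cannot serve as levels. *)
Definition half_unit : Ls -> R := 2^-1 *: (delta e \max (-1 *: delta e)).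

(* Homogeneous substitute for "[z] crosses the level -1/2 between [a] and [b] and
   the level 1/2 between [b] and [c]": the missing unit is |delta e|. *)
Definition triple_bump (t : L * L * L) : Ls -> R :=
  (-1 *: (delta t.1.1 + half_unit) \min (delta t.1.2 + half_unit)) \min
  ((half_unit + -1 *: delta t.1.2) \min (delta t.2 + -1 *: half_unit)).

Lemma triple_bump_gt0 t z : 0 < triple_bump t z <->
  [/\ z t.1.1 < - half_unit z, - half_unit z < z t.1.2,
      z t.1.2 < half_unit z & half_unit z < z t.2].
Proof.
rewrite /triple_bump /= !lt_min.
change (((0 < -1 * (z t.1.1 + half_unit z)) && (0 < z t.1.2 + half_unit z)) &&
  ((0 < half_unit z + -1 * z t.1.2) && (0 < z t.2 + -1 * half_unit z)) <->
  [/\ z t.1.1 < - half_unit z, - half_unit z < z t.1.2,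
      z t.1.2 < half_unit z & half_unit z < z t.2]).
rewrite -andbA; split=> [/and4P[]|[]] *;
  by [split; lra|apply/and4P; split; lra].
Qed.

Lemma separated_countable A : separated A -> countable A.
Proof.
move=> [At sepA]; have [_ FD FZ Fmin Fmax] := FBL_vector_sublattice.
have Fh : FBL R L half_unit.
  by apply: (FZ); apply: Fmax; [|apply: (FZ)]; apply: FBL_delta.
apply: (ccc_countable (p := triple_bump)) => [t|t /At[abc be]|t t' z At1 At1'].
- have Fd := FBL_delta; apply: (Fmin); apply: (Fmin).
  + by apply: (FZ); apply: (FD).
  + exact: FD.
  + by apply: (FD) => //; apply: (FZ).
  + by apply: (FD) => //; apply: (FZ).
- case/andP: abc => ab bc.
  (* The value 0 is taken only at the middle point, which is not [e]; hence |h e| = 1 and the levels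
     are -1/2 and 1/2. *)
  pose h w : R := if (w < t.1.2)%O then -1 else if (w == t.1.2)%O then 0 else 1.
  have hnd v w : (v <= w)%O -> h v <= h w.
    rewrite /h => vw; case: (ltgtP w t.1.2) => wb.
    + by rewrite (le_lt_trans vw wb).
    + by case: ifP => _; [|case: ifP => _]; lra.
    + by move: vw; rewrite wb; case: ltgtP => // _ _; lra.
  have hb w : -1 <= h w <= 1.
    by rewrite /h; case: ifP => _; [|case: ifP => _]; lra.
  have [z zE] := nondecreasing_dual hnd hb; exists z; apply/triple_bump_gt0.
  have -> : half_unit z = 2^-1.
    change (2^-1 * Num.max (z e) (-1 * z e) = 2^-1 :> R); rewrite zE /h.
    case: ltgtP => [_|_|eb]; last by case: be.
    + by rewrite max_r; lra.
    + by rewrite max_l; lra.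
  rewrite !zE /h ab ltxx eqxx (lt_gtF bc) (gt_eqF bc).
  by split; lra.
(* At a common point [z] both triples cross the same two levels, so each captures the middle point
   of the other. *)
- move=> /triple_bump_gt0[za zb1 zb2 zc] /triple_bump_gt0[za' zb1' zb2' zc'].
  have zlt v w : z v < z w -> (v < w)%O.
    by move=> vw; rewrite ltNge; apply/negP => /(dual_nondecreasing z); rewrite leNgt vw.
  by apply: sepA => //; apply/andP; split; apply: zlt; lra.
Qed.

(** Separation constrains at most two triples at a time, so it passes to unions of chains. *)
Lemma maximal_separated : exists A, separated A /\
  forall B, A `<` B -> ~ separated B.
Proof.
apply: Zorn_bigcup => F FP Ftot; split=> [t [X FX Xt]|]; first exact: (FP _ FX).1.
move=> t t' [X FX Xt] [Y FY Yt'].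
have [XY|YX] := Ftot _ _ FX FY.
- by apply: (FP _ FY).2 => //; apply: XY.
- by apply: (FP _ FX).2 => //; apply: YX.
Qed.

Lemma countable_dense_open : exists D : set L, countable D /\
  forall a b c, (a < b < c)%O -> exists2 b', D b' & (a < b' < c)%O.
Proof.
have [A [sepA maxA]] := maximal_separated.
(* The entry [(e, e, e)] is not a [triple]; it only puts [e] into the dense set. *)
exists ((fun t => t.1.2) @` (A `|` [set (e, e, e)])); split.
  apply: sub_countable (card_image_le _ _) _; apply: countable_setU.
  - exact: separated_countable.
  - exact: countable1.
move=> a b c abc.
have [be|be] := eqVneq b e; first by exists e; [exists (e, e, e); [right|]|rewrite -be].
apply: contrapT => noD.
(* So [(a, b, c)] can be added to [A]; it is new because it captures its own middle point. *)
have uncaptured t : A t -> ~~ captures (a, b, c) t.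
  move=> At; apply/negP => h; apply: noD; exists t.1.2 => //.
  by exists t => //; left.
apply: (maxA (A `|` [set (a, b, c)])).
  split=> [t At|]; first by left.
  by move=> /(_ (a, b, c) (or_intror erefl)) /uncaptured /negP; apply.
split=> [t [/sepA.1//|->]|t t' [At|->] [At'|->]//].
- by split=> //; apply/eqP.
- exact: sepA.2.
- by move=> _ h; have := uncaptured _ At; rewrite h.
- by move=> h; have := uncaptured _ At'; rewrite h.
Qed.

End Triples.

Lemma countable_dense : exists D : set L, countable D /\
  forall x y, (x < y)%O -> exists2 d', D d' & (x < d' <= y)%O.
Proof.
have [D [cD hD]] : exists D : set L, countable D /\
    forall a b c, (a < b < c)%O -> exists2 b', D b' & (a < b' < c)%O.
  (* The unit needs a point [e], so the empty order is treated apart. *)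
  have [[e _]|h] := pselect (exists e : L, True).
    exact: countable_dense_open e.
  by exists set0; split=> [|a]; [exact: countable0|case: h; exists a].
exists (D `|` snd @` jump); split.
  apply: countable_setU => //.
  by apply: sub_countable (card_image_le _ _) _; apply: countable_jump.
move=> x y xy; have [[z xzy]|h] := pselect (exists z, (x < z < y)%O).
  have [b Db /andP[xb /ltW yb]] := hD _ _ _ xzy.
  by exists b; [left|rewrite xb].
exists y; last by rewrite xy lexx.
right; exists (x, y) => //; split=> // z; apply/negP => xzy.
by apply: h; exists z.
Qed.

End CCCEmbeddable.

(** * Embedding into the line from a countable dense set *)

Section CountableDense.
Local Open Scope ring_scope.

Lemma countable_dense_embedding (R : realType) (d : Order.disp_t)
    (L : orderType d) (D : set L) : countable D ->
  (forall x y, (x < y)%O -> exists2 d', D d' & (x < d' <= y)%O) ->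
  exists phi : L -> R, {mono phi : x y / (x <= y)%O}.
Proof.
move=> /countable_injP[code code_inj] hD.
pose below x n := `[< exists2 d', D d' /\ code d' = n & (d' <= x)%O >].
pose u x (n : nat) : R := (below x n)%:R * 2^-1 ^+ n.
have u_ge0 x n : 0 <= u x n by rewrite mulr_ge0// exprn_ge0.
have cvgu x : cvgn (series (u x)).
  apply: (@series_le_cvg _ _ (geometric 1 2^-1)) => // [n|n|].
  - by rewrite /= mul1r exprn_ge0.
  - by rewrite /u /= ler_wpM2r ?exprn_ge0// lern1 leq_b1.
  - by apply: is_cvg_geometric_series; rewrite ger0_norm//; lra.
exists (fun x => limn (series (u x))); apply: le_mono => x y xy.
have [c Dc /andP[xc cy]] := hD _ _ xy.
have below_mono n : below x n -> below y n.
  move=> /asboolP[b hb bx]; apply/asboolP; exists b => //.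
  exact: le_trans bx (ltW xy).
have u_mono n : u x n <= u y n.
  rewrite /u ler_wpM2r ?exprn_ge0// ler_nat.
  by case: (below x n) (below_mono n) => // ->.
(* Strictness could be lost in the limit; a fixed gap, the term of [c], which lies below [y] but not
   below [x], survives. *)
suff : limn (series (u x)) + 2^-1 ^+ code c <= limn (series (u y)).
  by apply: lt_le_trans; rewrite ltrDl exprn_gt0.
apply: (ler_cvg_to (cvgD (cvgu x) (cvg_cst _)) (cvgu y)).
exists (code c).+1 => // n /= cn.
rewrite -lerBrDl /series /= -sumrB big_mkord (bigD1 (Ordinal cn)) //=.
rewrite /u.
have -> : below y (code c) by apply/asboolP; exists c.
have -> : below x (code c) = false.
  apply/asboolP => -[b [Db /code_inj bc]]; rewrite bc ?inE//.
  by rewrite leNgt xc.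
rewrite mul0r subr0 mul1r lerDl; apply: sumr_ge0 => i _.
by rewrite subr_ge0 u_mono.
Qed.

End CountableDense.

Theorem theorem5p1 (R : realType) (d : Order.disp_t) (L : orderType d) :
  has_ccc (FBL R L) <-> exists S : set R, order_isomorphic_to L S.
Proof.
split=> [/countable_dense[D [cD /(countable_dense_embedding R cD)[phi phi_mono]]]|].
  exists (range phi), phi => //; split=> // x y _ _; apply: (inc_inj phi_mono).
by move=> [S [phi _ phi_mono]]; apply: embeddable_ccc phi_mono.
Qed.
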